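(* Let $\Gamma$ be a variable typing environment and $\Delta$ a safe operator typing environment such that $\Gamma,\Delta\vdash C:\alpha$ and $\Gamma,\Delta\vdash D:\alpha$ for commands $C,D$ and a tier $\alpha$. Assume $\mu\vDash C\approx_{\Gamma,\Delta}\sigma\vDash D$. If $\mu\vDash C\Rightarrow^t\mu'\vDash C'$, then there exist $\sigma'$ and $D'$ such that $\sigma\vDash D\Rightarrow^t\sigma'\vDash D'$ and $\mu'\vDash C'\approx_{\Gamma,\Delta}\sigma'\vDash D'$.
   Context: Words: $\mathcal{W}$ is the set of finite words over a finite alphabet $\Sigma$, containing distinguished words $\texttt{tt},\texttt{ff}$. Operators $op$ have fixed arity $n\ge0$ and are interpreted as total functions $[\![op]\!]:\mathcal{W}^n\to\mathcal{W}$. Expressions: $E ::= X \mid op(E_1,\dots,E_n)$. Commands: $C ::= X:=E \mid C;C' \mid \texttt{skip}\mid \texttt{if } E\texttt{ then } C\texttt{ else } C'\mid\texttt{while}(E)\{C\}$. A store $\mu$ maps variables to words. Expression evaluation $\mu\vDash E\Downarrow d$: $X$ evaluates to $\mu(X)$; $op(E_1,\dots,E_n)$ to $[\![op]\!](d_1,\dots,d_n)$. Small-step relation $\to_s$ on configurations ($\mu\vDash C$ or a store): $\mu\vDash\texttt{skip}\to_s\mu$; $\mu\vDash X:=E\to_s\mu[X\leftarrow d]$ with $\mu\vDash E\Downarrow d$; if $\mu\vDash C_1\to_s\mu_1$ then $\mu\vDash C_1;C_2\to_s\mu_1\vDash C_2$; if $\mu\vDash C_1\to_s\mu_1\vDash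 C_1'$ then $\mu\vDash C_1;C_2\to_s\mu_1\vDash C_1';C_2$; if $E$ evaluates to $w\in\{\texttt{tt},\texttt{ff}\}$ then $\mu\vDash\texttt{if }E\texttt{ then }C_{\texttt{tt}}\texttt{ else }C_{\texttt{ff}}\to_s\mu\vDash C_w$; if $E$ evaluates to $\texttt{ff}$ then $\mu\vDash\texttt{while}(E)\{C\}\to_s\mu$; if $E$ evaluates to $\texttt{tt}$ then $\mu\vDash\texttt{while}(E)\{C\}\to_s\mu\vDash C;\texttt{while}(E)\{C\}$ (the loop-unfolding rule). Loop-length relation: $\mu\vDash C\Rightarrow^t\mu'\vDash C'$ iff there is a finite sequence of $\to_s$-steps from $\mu\vDash C$ to $\mu'\vDash C'$ in which the loop-unfolding rule is applied exactly $t$ times (counting, in each step, the application of that rule at the innermost position in the derivation through the sequencing rules). Tiers $\mathbf{0}\preceq\mathbf{1}$ with $\vee,\wedge$. $\Gamma$ maps variables to tiers; $\Delta$ maps each operator of arity $n$ to a set of types $\alpha_1\to\cdots\to\alpha_n\to\alpha$. Typing: $\Gamma,\Delta\vdash X:\Gamma(X)$; $op(E_1,\dots,E_n):\alpha$ if $E_i:\alpha_i$ and $\alpha_1\to\cdots\to\alpha_n\to\alpha\in\Delta(op)$; $X:=E:\beta$ if $X:\beta$, $E:\alpha$, $\beta\preceq\alpha$; $C;C':\alpha\vee\beta$ if $C:\alpha$, $C':\beta$; $\texttt{skip}:\alpha$ for any $\alpha$; $\texttt{if }E\texttt{ then }C\texttt{ else }C':\alpha$ if $E,C,C'$ all have type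 $\alpha$; $\texttt{while}(E)\{C\}:\mathbf{1}$ if $E:\mathbf{1}$ and $C:\alpha$ for some $\alpha$. Neutral operator: $[\![op]\!]$ takes only values $\texttt{tt},\texttt{ff}$, or for all arguments the result is a sub-word (factor $w=uvu'$) of some argument. Positive operator: $|[\![op]\!](d_1,\dots,d_n)|\le\max_i|d_i|+c$ for a constant $c$. Standing assumption: every operator is neutral or positive. $\Delta$ is safe if every type $\alpha_1\to\cdots\to\alpha_n\to\alpha\in\Delta(op)$ satisfies $\alpha\preceq\bigwedge_i\alpha_i$, and $\alpha=\mathbf{0}$ if $op$ is positive but not neutral. Equivalence: $\mu\approx_{\Gamma,\Delta}\sigma$ iff $\mu(X)=\sigma(X)$ for all $X\in\mathrm{dom}(\Gamma)$ with $\Gamma(X)=\mathbf{1}$. On commands, $\approx_{\Gamma,\Delta}$ is the least relation with: $C\approx C$; $C\approx C'$ whenever both have type $\mathbf{0}$ under $\Gamma,\Delta$; $C\approx C'$ and $D\approx D'$ imply $C;D\approx C';D'$. On configurations: $\mu\vDash C\approx\sigma\vDash C'$ iff $C\approx C'$ and $\mu\approx\sigma$.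
   Formalization: Added assumption: in every execution from σ⊨D, each tier-0 conditional about to be executed has a test evaluating to tt or ff; otherwise a non-boolean tier-0 test can block D while C goes on to unfold a loop, and the claim fails. *)

(* Defs.v *)
From HB Require Import structures.
From mathcomp Require Import all_boot all_order.

Set Implicit Arguments.
Unset Strict Implicit.
Unset Printing Implicit Defensive.

(* [wtt] and [wff] are the truth values; their distinctness is not needed and
   is not imposed. *)
Record language := Language {
  letter : finType;
  wtt : seq letter;
  wff : seq letter;
  var : eqType;
  op : Type;
  arity : op -> nat;
  den : forall o : op, {ffun 'I_(arity o) -> seq letter} -> seq letter }.

Definition word (L : language) := seq (letter L).

Inductive expr (L : language) : Type :=
| Var (X : var L)
| Op (o : op L) (Es : {ffun 'I_(arity o) -> expr L}).

Inductive command (L : language) : Type :=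
| Assign (X : var L) (E : expr L)
| Seq (C D : command L)
| Skip
| If (E : expr L) (C D : command L)
| While (E : expr L) (C : command L).
Arguments Skip {L}.

Definition store (L : language) := var L -> word L.

Definition update (L : language) (mu : store L) (X : var L) (d : word L) :
  store L := fun Y => if Y == X then d else mu Y.

(* Expression evaluation is total and deterministic, hence a function. *)
Fixpoint eval (L : language) (mu : store L) (E : expr L) : word L :=
  match E with
  | Var X => mu X
  | Op o Es => den [ffun i => eval mu (Es i)]
  end.

Inductive config (L : language) : Type :=
| Run (mu : store L) (C : command L)
| Done (mu : store L).

(* [step u c c'] : one small step; [u] records whether the rule applied at the
   innermost position of the derivation is loop unfolding. *)
Inductive step (L : language) : bool -> config L -> config L -> Prop :=
| StepSkip mu : step false (Run mu Skip) (Done mu)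
| StepAssign mu X E :
    step false (Run mu (Assign X E)) (Done (update mu X (eval mu E)))
| StepSeqDone u mu mu1 C1 C2 :
    step u (Run mu C1) (Done mu1) ->
    step u (Run mu (Seq C1 C2)) (Run mu1 C2)
| StepSeqRun u mu mu1 C1 C1' C2 :
    step u (Run mu C1) (Run mu1 C1') ->
    step u (Run mu (Seq C1 C2)) (Run mu1 (Seq C1' C2))
| StepIfTrue mu E C D :
    eval mu E = wtt L -> step false (Run mu (If E C D)) (Run mu C)
| StepIfFalse mu E C D :
    eval mu E = wff L -> step false (Run mu (If E C D)) (Run mu D)
| StepWhileFalse mu E C :
    eval mu E = wff L -> step false (Run mu (While E C)) (Done mu)
| StepWhileTrue mu E C :
    eval mu E = wtt L ->
    step true (Run mu (While E C)) (Run mu (Seq C (While E C))).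

Inductive loop_length (L : language) : config L -> nat -> config L -> Prop :=
| LoopRefl c : loop_length c 0 c
| LoopStep u t c c1 c' :
    step u c c1 -> loop_length c1 t c' -> loop_length c (u + t) c'.

(* Tiers: [false] is tier 0 and [true] is tier 1, so that the order, join and
   meet of tiers are those of the library on [bool]. *)
Notation tier := bool (only parsing).
Notation tier0 := false (only parsing).
Notation tier1 := true (only parsing).

(* [(a, b)] stands for a_1 -> ... -> a_n -> b. *)
Definition op_type (n : nat) : Type := ({ffun 'I_n -> tier} * tier)%type.

(* A variable X is in dom(G) when [G X] is not [None]. *)
Definition var_env (L : language) := var L -> option tier.

Definition op_env (L : language) := forall o : op L, op_type (arity o) -> Prop.

Inductive expr_type (L : language) (G : var_env L) (D : op_env L) :
  expr L -> tier -> Prop :=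
| TVar X a : G X = Some a -> expr_type G D (Var X) a
| TOp (o : op L) (Es : {ffun 'I_(arity o) -> expr L})
    (a : {ffun 'I_(arity o) -> tier}) (b : tier) :
    (forall i, expr_type G D (Es i) (a i)) -> D o (a, b) ->
    expr_type G D (Op Es) b.

Inductive cmd_type (L : language) (G : var_env L) (D : op_env L) :
  command L -> tier -> Prop :=
| TAssign X E (a b : tier) :
    expr_type G D (Var X) b -> expr_type G D E a -> (b <= a)%O ->
    cmd_type G D (Assign X E) b
| TSeq C C' (a b : tier) :
    cmd_type G D C a -> cmd_type G D C' b ->
    cmd_type G D (Seq C C') (Order.join a b)
| TSkip a : cmd_type G D Skip a
| TIf E C C' a :
    expr_type G D E a -> cmd_type G D C a -> cmd_type G D C' a ->
    cmd_type G D (If E C C') a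
| TWhile E C a :
    expr_type G D E tier1 -> cmd_type G D C a ->
    cmd_type G D (While E C) tier1.

Definition neutral (L : language) (o : op L) : Prop :=
  (forall d, @den L o d = wtt L \/ @den L o d = wff L)
  \/ (forall d, exists i, infix (@den L o d) (d i)).

Definition positive (L : language) (o : op L) : Prop :=
  exists c : nat, forall d : {ffun 'I_(arity o) -> word L},
    size (den d) <= \max_i size (d i) + c.

Definition safe (L : language) (D : op_env L) : Prop :=
  forall (o : op L) (a : {ffun 'I_(arity o) -> tier}) (b : tier),
    D o (a, b) ->
    (b <= \meet_i a i)%O /\ (positive o -> ~ neutral o -> b = tier0).

Definition store_equiv (L : language) (G : var_env L) (mu sg : store L) :
  Prop := forall X, G X = Some tier1 -> mu X = sg X.

Inductive cmd_equiv (L : language) (G : var_env L) (D : op_env L) :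
  command L -> command L -> Prop :=
| EqvRefl C : cmd_equiv G D C C
| EqvTier0 C C' :
    cmd_type G D C tier0 -> cmd_type G D C' tier0 -> cmd_equiv G D C C'
| EqvSeq C C' B B' :
    cmd_equiv G D C C' -> cmd_equiv G D B B' ->
    cmd_equiv G D (Seq C B) (Seq C' B').

(* Only configurations that still carry a command are compared. *)
Definition config_equiv (L : language) (G : var_env L) (D : op_env L)
    (c c' : config L) : Prop :=
  match c, c' with
  | Run mu C, Run sg C' => cmd_equiv G D C C' /\ store_equiv G mu sg
  | _, _ => False
  end.

(* The component of a command that the next step executes. *)
Fixpoint active (L : language) (C : command L) : command L :=
  if C is Seq C1 _ then active C1 else C.

(* Words are untyped, so a conditional blocks when its test is neither [wtt]
   nor [wff].  Equivalent configurations may disagree on a test of tier 0, so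
   one may block there while the other goes on to execute loops.  This
   predicate says that no such test met when running [c] blocks. *)
Definition tier0_tests_boolean (L : language) (G : var_env L) (D : op_env L)
    (c : config L) : Prop :=
  forall (t : nat) (mu : store L) (B : command L)
         (E : expr L) (B1 B2 : command L),
    loop_length c t (Run mu B) -> active B = If E B1 B2 ->
    cmd_type G D (If E B1 B2) tier0 ->
    eval mu E = wtt L \/ eval mu E = wff L.

(* Main.v *)
Require Import Defs.
From HB Require Import structures.
From mathcomp Require Import all_boot all_order.

(** Commands of tier 0 contain no loop and never write a variable of tier 1,
    whereas tests and right-hand sides of tier 1 depend only on variables of
    tier 1.  Hence each step of the first command is matched with the same
    number of unfoldings: inside a component of tier 0 the second command
    waits, and when that component ends it runs its own counterpart to the end,
    which is possible because a command of tier 0 whose tests do not block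
    terminates; elsewhere both commands take the same step. *)

(** * Runs, sequencing and Boolean tests *)

Definition seq_config {L : language} (c : config L) (B : command L) :
    config L :=
  match c with
  | Run mu C => Run mu (Seq C B)
  | Done mu => Run mu B
  end.

Definition config_store {L : language} (c : config L) : store L :=
  match c with Run mu _ => mu | Done mu => mu end.

(** A terminal configuration counts as typed at every tier, so that typing can be followed through a
    final step. *)
Definition config_type {L : language} (G : var_env L) (D : op_env L)
    (c : config L) (a : bool) : Prop :=
  if c is Run _ C then cmd_type G D C a else True.

(* [config_equiv] relates no terminal configuration, but the first component of
   a sequence may end in one step, so the simulation must cover that case. *)
Definition result_equiv {L : language} (G : var_env L) (D : op_env L)
    (c c' : config L) : Prop :=
  match c, c' with
  | Done mu, Done sg => store_equiv G mu sg
  | _, _ => config_equiv G D c c'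
  end.

Lemma loop_length_step {L : language} u (c c' : config L) :
  step u c c' -> loop_length c u c'.
Proof.
by move=> s; rewrite -[nat_of_bool u]addn0; apply: LoopStep s (LoopRefl _).
Qed.

Lemma loop_length_trans {L : language} {t1 t2} {c1 c2 c3 : config L} :
  loop_length c1 t1 c2 -> loop_length c2 t2 c3 -> loop_length c1 (t1 + t2) c3.
Proof.
by elim=> [//|u t c c' c'' s _ IH] /IH h; rewrite -addnA; apply: LoopStep s h.
Qed.

(** The two shapes of the target correspond to the two sequencing rules; a terminal source has no
    step. *)
Lemma step_seq {L : language} u (c c' : config L) B :
  step u c c' -> step u (seq_config c B) (seq_config c' B).
Proof.
by case: c' => [sg C'|sg]; case: c => [mu C|mu] s /=;
  [exact: StepSeqRun | inversion s | exact: StepSeqDone | inversion s].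
Qed.

Lemma loop_length_seq {L : language} t (c c' : config L) B :
  loop_length c t c' -> loop_length (seq_config c B) t (seq_config c' B).
Proof.
elim=> [c0|u t0 c0 c1 c2 s _ IH]; first exact: LoopRefl.
exact: LoopStep (step_seq _ _ _ B s) IH.
Qed.

Lemma tests_loop_length {L : language} (G : var_env L) (D : op_env L) t c c' :
  loop_length c t c' -> tier0_tests_boolean G D c -> tier0_tests_boolean G D c'.
Proof.
by move=> h tests t' mu B E B1 B2 /(loop_length_trans h); apply: tests.
Qed.

(** Every run of [C] lifts to [Seq C B] with the same active component, because [active] only
    descends to the left. *)
Lemma tests_seq {L : language} (G : var_env L) (D : op_env L) sg C B :
  tier0_tests_boolean G D (Run sg (Seq C B)) ->
  tier0_tests_boolean G D (Run sg C).
Proof.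
move=> tests t mu C' E B1 B2 /(loop_length_seq _ _ _ B) h.
exact: (tests _ _ (Seq C' B) _ _ _ h).
Qed.

(** * Non-interference for stores and expressions *)

Lemma store_equiv_refl {L : language} (G : var_env L) mu : store_equiv G mu mu.
Proof. by []. Qed.

Lemma store_equiv_sym {L : language} (G : var_env L) mu sg :
  store_equiv G mu sg -> store_equiv G sg mu.
Proof. by move=> e X gX; rewrite e. Qed.

Lemma store_equiv_trans {L : language} (G : var_env L) mu sg ta :
  store_equiv G mu sg -> store_equiv G sg ta -> store_equiv G mu ta.
Proof. by move=> e1 e2 X gX; rewrite e1 ?e2. Qed.

(** Safety puts the result tier below every argument tier, so all variables of an expression of tier
    1 have tier 1. *)
Lemma eval_tier1 {L : language} (G : var_env L) (D : op_env L) mu sg E :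
  safe D -> store_equiv G mu sg -> expr_type G D E true ->
  eval mu E = eval sg E.
Proof.
move=> hsafe eqv hE.
suff gen b : expr_type G D E b -> b = true -> eval mu E = eval sg E.
  exact: gen hE erefl.
elim=> {E hE b}.
  by move=> X b gX b1; apply: eqv; rewrite gX b1.
move=> o Es a b _ IH /hsafe [le_b _] b1 /=; congr (den _).
apply/ffunP => i; rewrite !ffunE; apply: IH.
have le_i := Order.TMeetTheory.meets_inf a (erefl : predT i).
by move: (Order.POrderTheory.le_trans le_b le_i); rewrite b1; case: (a i).
Qed.

(** If [X] has tier 1, the rule for assignments forces [E] to tier 1, so both values agree;
    otherwise the write is invisible to the equivalence. *)
Lemma update_equiv {L : language} (G : var_env L) (D : op_env L) mu sg X E a :
  safe D -> cmd_type G D (Assign X E) a -> store_equiv G mu sg ->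
  store_equiv G (update mu X (eval mu E)) (update sg X (eval sg E)).
Proof.
move=> hsafe hX eqv Y gY; rewrite /update; case: eqP => [YX|_]; last exact: eqv.
inversion hX as [X' E' a' b' tX tE le_ba| | | |]; subst.
inversion tX as [X' b' gX|]; subst.
move: gX le_ba; rewrite gY => -[<-]; case: a' tE => // tE _.
exact: eval_tier1 hsafe eqv tE.
Qed.

Lemma update_tier0 {L : language} (G : var_env L) (D : op_env L) mu X E w :
  cmd_type G D (Assign X E) false -> store_equiv G mu (update mu X w).
Proof.
move=> hX Y gY; rewrite /update; case: eqP => [YX|//].
inversion hX as [X' E' a' b' tX| | | |]; subst.
by inversion tX as [X' b' gX|]; subst; move: gX; rewrite gY.
Qed.

(** * Tiers along execution *)

Lemma seq_type_inv {L : language} (G : var_env L) (D : op_env L) C B a :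
  cmd_type G D (Seq C B) a ->
  exists b c, [/\ cmd_type G D C b, cmd_type G D B c & a = b || c].
Proof.
by move=> h; inversion h as [|C' B' b c hC hB| | |]; subst; exists b, c.
Qed.

Lemma if_type_inv {L : language} (G : var_env L) (D : op_env L) E C B a :
  cmd_type G D (If E C B) a ->
  [/\ expr_type G D E a, cmd_type G D C a & cmd_type G D B a].
Proof. by move=> h; inversion h. Qed.

Lemma while_type_inv {L : language} (G : var_env L) (D : op_env L) E C a :
  cmd_type G D (While E C) a ->
  [/\ expr_type G D E true, exists b, cmd_type G D C b & a].
Proof.
by move=> h; inversion h as [| | | |E' C' b]; subst; split=> //; exists b.
Qed.

(** The tier may drop, as when a first component of tier 1 ends and leaves a second one of tier
    0. *)
Lemma step_type {L : language} (G : var_env L) (D : op_env L) u c c' a :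
  step u c c' -> config_type G D c a ->
  exists2 b : bool, (b <= a)%O & config_type G D c' b.
Proof.
move=> s; elim: s a => {u c c'} /=.
- by move=> mu a _; exists a.
- by move=> mu X E a _; exists a.
- move=> u mu mu1 C1 C2 _ _ a /seq_type_inv [b [c [_ h2 ->]]].
  by exists c => //; case: b c {h2} => -[].
- move=> u mu mu1 C1 C1' C2 _ IH a /seq_type_inv [b [c [/IH [b' le_b h1] h2 ->]]].
  by exists (b' || c); [case: b' b c le_b {IH h1 h2} => -[] [] | apply: (TSeq h1 h2)].
- by move=> mu E C1 C2 _ a /if_type_inv [_ h _]; exists a.
- by move=> mu E C1 C2 _ a /if_type_inv [_ _ h]; exists a.
- by move=> mu E C _ a _; exists a.
- move=> mu E C _ a hW; have [hE [b hC] ha] := while_type_inv _ _ _ _ _ hW.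
  exists true; first by rewrite ha.
  (* The unfolded loop has tier [b || true], the join of the tiers of body and loop. *)
  by rewrite -(orbT b); apply: (TSeq hC); apply: TWhile hE hC.
Qed.

Lemma step_tier0 {L : language} (G : var_env L) (D : op_env L) u c c' :
  step u c c' -> config_type G D c false ->
  u = false /\ store_equiv G (config_store c) (config_store c').
Proof.
elim=> {u c c'} //=.
- by move=> mu X E hX; split=> //; apply: update_tier0 hX.
- by move=> u mu mu1 C1 C2 _ IH /seq_type_inv [[] [c []]] // /IH.
- by move=> u mu mu1 C1 C1' C2 _ IH /seq_type_inv [[] [c []]] // /IH.
- by move=> mu E C _ /while_type_inv [].
Qed.

(** Structural induction suffices: loops have tier 1, and every other command continues with its own
    subcommands. *)
Lemma tier0_terminates {L : language} (G : var_env L) (D : op_env L) sg C :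
  cmd_type G D C false -> tier0_tests_boolean G D (Run sg C) ->
  exists2 sg', loop_length (Run sg C) 0 (Done sg') & store_equiv G sg sg'.
Proof.
elim: C sg => [X E|C1 IH1 C2 IH2||E C1 IH1 C2 IH2|E C IH] sg hC tests.
- exists (update sg X (eval sg E)); last exact: update_tier0 hC.
  exact: loop_length_step (StepAssign _ _ _).
- have [[] [[] [h1 h2]]] // := seq_type_inv _ _ _ _ _ hC; move=> _.
  have [sg1 r1 e1] := IH1 _ h1 (tests_seq _ _ _ _ _ tests).
  have r1' := loop_length_seq _ _ _ C2 r1.
  have [sg2 r2 e2] := IH2 _ h2 (tests_loop_length _ _ _ _ _ r1' tests).
  exists sg2; last exact: store_equiv_trans e1 e2.
  exact: loop_length_trans r1' r2.
- exists sg; last exact: store_equiv_refl.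
  exact: loop_length_step (StepSkip _).
- have [_ h1 h2] := if_type_inv _ _ _ _ _ _ hC.
  (* The conditional is its own active component, so the empty run makes its test Boolean. *)
  have [Ew|Ew] := tests _ _ _ _ _ _ (LoopRefl _) erefl hC.
  + have s := loop_length_step _ _ _ (StepIfTrue C1 C2 Ew).
    have [sg' r e] := IH1 _ h1 (tests_loop_length _ _ _ _ _ s tests).
    by exists sg' => //; apply: loop_length_trans s r.
  + have s := loop_length_step _ _ _ (StepIfFalse C1 C2 Ew).
    have [sg' r e] := IH2 _ h2 (tests_loop_length _ _ _ _ _ s tests).
    by exists sg' => //; apply: loop_length_trans s r.
- by have [] := while_type_inv _ _ _ _ _ hC.
Qed.

(** * Simulation of steps and runs *)

Lemma seq_equiv_inv {L : language} (G : var_env L) (D : op_env L) B1 B2 C :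
  cmd_equiv G D (Seq B1 B2) C ->
  (cmd_type G D (Seq B1 B2) false /\ cmd_type G D C false) \/
  exists C1 C2, [/\ C = Seq C1 C2, cmd_equiv G D B1 C1 & cmd_equiv G D B2 C2].
Proof.
move=> h; inversion h as [|? ? h1 h2|? C1 ? C2 h1 h2]; subst; last 1 first.
- by right; exists C1, C2.
(* A reflexive pair is split by components, so that the induction in [step_sim] covers it too. *)
- by right; exists B1, B2; split=> //; apply: EqvRefl.
- by left.
Qed.

Lemma nonseq_equiv_inv {L : language} (G : var_env L) (D : op_env L) B C :
  cmd_equiv G D B C -> ~~ (if B is Seq _ _ then true else false) ->
  (cmd_type G D B false /\ cmd_type G D C false) \/ C = B.
Proof.
case=> [C0|C0 C0' h1 h2|C1 C1' C2 C2' //]; auto.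
Qed.

Lemma tier0_step_sim {L : language} (G : var_env L) (D : op_env L)
    u mu sg B C c' :
  cmd_type G D B false -> cmd_type G D C false -> store_equiv G mu sg ->
  tier0_tests_boolean G D (Run sg C) -> step u (Run mu B) c' ->
  exists2 c2, loop_length (Run sg C) u c2 & result_equiv G D c' c2.
Proof.
move=> hB hC eqv tests s.
have [u0 /= e1] := step_tier0 _ _ _ _ _ s hB; rewrite u0.
have e1' := store_equiv_trans _ _ _ _ (store_equiv_sym _ _ _ e1) eqv.
have [b le_b] := step_type _ _ _ _ _ _ s hB.
case: c' s e1 e1' => [mu1 B1|mu1] s e1 /= e1' hB1.
  (* The second command waits; what remains of the first still has tier 0, since [b] lies below tier
     0. *)
  exists (Run sg C); first exact: LoopRefl.
  by split=> //; apply: EqvTier0 => //; case: b le_b hB1.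
have [sg' r e2] := tier0_terminates _ _ _ _ hC tests.
by exists (Done sg') => //=; apply: store_equiv_trans e1' e2.
Qed.

(** Outside sequences, equivalent commands are both of tier 0 or equal, and equal ones agree on
    tests of tier 1; sequences reduce to their first components. *)
Lemma step_sim {L : language} (G : var_env L) (D : op_env L)
    u mu sg B C c' a :
  safe D -> cmd_type G D B a -> cmd_equiv G D B C -> store_equiv G mu sg ->
  tier0_tests_boolean G D (Run sg C) -> step u (Run mu B) c' ->
  exists2 c2, loop_length (Run sg C) u c2 & result_equiv G D c' c2.
Proof.
move=> hsafe; elim: B u C c' a => [X E|B1 IH B2 _||E B1 _ B2 _|E B1 _] u C c' a hB.
- move=> /nonseq_equiv_inv /(_ isT) [[hB0 hC]|->] eqv tests s.
    exact: tier0_step_sim hB0 hC eqv tests s.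
  inversion s; subst; exists (Done (update sg X (eval sg E))).
    exact: loop_length_step (StepAssign _ _ _).
  exact: update_equiv hsafe hB eqv.
- move/seq_equiv_inv => [[hB0 hC] eqv|[C1 [C2 [-> e1 e2]]] eqv] tests s.
    exact: tier0_step_sim hB0 hC eqv tests s.
  have [b [_ [h1 _ _]]] := seq_type_inv _ _ _ _ _ hB.
  have {}IH c s1 := IH u C1 c b h1 e1 eqv (tests_seq _ _ _ _ _ tests) s1.
  inversion s as [| |? ? mu1 ? ? s1|? ? mu1 ? B1' ? s1| | | |]; subst.
  + have [[//|sg1] r e] := IH _ s1.
    (* Both first components have ended, so [B2] now faces [C2] in equivalent stores. *)
    by exists (Run sg1 C2); [exact: loop_length_seq r|].
  + have [[sg1 C1'|//] r [e eqv1]] := IH _ s1.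
    exists (Run sg1 (Seq C1' C2)); first exact: loop_length_seq r.
    by split=> //; apply: EqvSeq.
- move=> /nonseq_equiv_inv /(_ isT) [[hB0 hC]|->] eqv tests s.
    exact: tier0_step_sim hB0 hC eqv tests s.
  inversion s; subst; exists (Done sg) => //.
  exact: loop_length_step (StepSkip _).
- move=> /nonseq_equiv_inv /(_ isT) [[hB0 hC]|->] eqv tests s.
    exact: tier0_step_sim hB0 hC eqv tests s.
  case: a hB => hB; last first.
    (* Even identical conditionals of tier 0 may branch differently, so they are treated as an
       arbitrary pair of tier 0. *)
    exact: (tier0_step_sim _ _ _ _ _ _ _ _ hB hB eqv tests s).
  have [hE _ _] := if_type_inv _ _ _ _ _ _ hB.
  have eqE := eval_tier1 _ _ _ _ _ hsafe eqv hE.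
  inversion s as [| | | |? ? ? ? Ew|? ? ? ? Ew| |]; subst; rewrite eqE in Ew.
  + exists (Run sg B1); first exact: loop_length_step (StepIfTrue _ _ Ew).
    by split=> //; apply: EqvRefl.
  + exists (Run sg B2); first exact: loop_length_step (StepIfFalse _ _ Ew).
    by split=> //; apply: EqvRefl.
- move=> /nonseq_equiv_inv /(_ isT) [[hB0 hC]|->] eqv tests s.
    exact: tier0_step_sim hB0 hC eqv tests s.
  have [hE _ _] := while_type_inv _ _ _ _ _ hB.
  have eqE := eval_tier1 _ _ _ _ _ hsafe eqv hE.
  inversion s as [| | | | | |? ? ? Ew|? ? ? Ew]; subst; rewrite eqE in Ew.
  + exists (Done sg) => //; exact: loop_length_step (StepWhileFalse _ Ew).
  + exists (Run sg (Seq B1 (While E B1))).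
      exact: loop_length_step (StepWhileTrue _ Ew).
    by split=> //; apply: EqvRefl.
Qed.

Lemma loop_length_sim {L : language} (G : var_env L) (D : op_env L)
    c1 t c1' c2 a :
  safe D -> config_type G D c1 a -> result_equiv G D c1 c2 ->
  tier0_tests_boolean G D c2 -> loop_length c1 t c1' ->
  exists2 c2', loop_length c2 t c2' & result_equiv G D c1' c2'.
Proof.
move=> hsafe hc1 eqv tests r.
(* The tier is generalized because it may change at each step. *)
elim: r a c2 hc1 eqv tests => [c|u t0 c c' c'' s _ IH] a c2 hc eqv tests.
  by exists c2 => //; apply: LoopRefl.
case: c s hc eqv => [mu B|mu] s hB; last by inversion s.
case: c2 tests => [sg C|//] tests [e eqv].
have [c3 r3 e3] := step_sim _ _ _ _ _ _ _ _ _ hsafe hB e eqv tests s.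
have [b _ hc'] := step_type _ _ _ _ _ _ s hB.
have [c4 r4 e4] := IH _ _ hc' e3 (tests_loop_length _ _ _ _ _ r3 tests).
by exists c4 => //; apply: loop_length_trans r3 r4.
Qed.

Theorem theorem3 (L : language)
  (hop : forall o : op L, neutral o \/ positive o)
  (Gamma : var_env L) (Delta : op_env L) (hsafe : safe Delta)
  (C D : command L) (alpha : tier)
  (hC : cmd_type Gamma Delta C alpha) (hD : cmd_type Gamma Delta D alpha)
  (mu sigma : store L)
  (heqv : config_equiv Gamma Delta (Run mu C) (Run sigma D))
  (htests : tier0_tests_boolean Gamma Delta (Run sigma D))
  (t : nat) (mu' : store L) (C' : command L)
  (hrun : loop_length (Run mu C) t (Run mu' C')) :
  exists (sigma' : store L) (D' : command L),
    loop_length (Run sigma D) t (Run sigma' D') /\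
    config_equiv Gamma Delta (Run mu' C') (Run sigma' D').
Proof.
(* A running configuration is never related to a terminal one, so the matching run ends in a
   [Run]. *)
have [[sg D'|//] r e] :=
  loop_length_sim _ _ (Run mu C) _ _ _ _ hsafe hC heqv htests hrun.
by exists sg, D'.
Qed.
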